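(* There is a dense countable subset $X\subset 2^{\mathfrak c}$ such that $X$ (with the subspace topology) is not D-separable.
   Context: $\mathfrak c$ is the cardinality of the continuum, and $2^{\mathfrak c}$ is the product of $\mathfrak c$ copies of the two-point discrete space $\{0,1\}$ with the Tychonoff product topology. A subset is discrete if it is discrete in its subspace topology. A space $X$ is D-separable if for every sequence $(D_n:n\in\omega)$ of dense subspaces of $X$ one can pick discrete sets $F_n\subset D_n$ so that $\bigcup_{n\in\omega}F_n$ is dense in $X$. *)

(* Defs.v *)
From HB Require Import structures.
From mathcomp Require Import all_boot all_order all_algebra.
From mathcomp Require Import all_classical all_reals all_analysis.

Set Implicit Arguments.
Unset Strict Implicit.
Unset Printing Implicit Defensive.

Local Open Scope classical_set_scope.
Local Open Scope card_scope.

Definition has_card_continuum (I : Type) : Prop :=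
  [set: I] #= [set: nat -> bool].

(* [set_type A] carries the initial topology of the inclusion, i.e. the genuine
   subspace topology; the library's [subspace A] is a different topology, on
   the whole of [T], in which the points outside of [A] are isolated. *)
Definition discrete_subset (T : topologicalType) (A : set T) : Prop :=
  forall U : set (set_type A), open U.

Definition D_separable (T : topologicalType) : Prop :=
  forall D : nat -> set T, (forall n, dense (D n)) ->
  exists F : nat -> set T,
    (forall n, F n `<=` D n /\ discrete_subset (F n)) /\
    dense (\bigcup_n F n).

(* Main.v *)
(** Index the coordinates by [nat -> bool] through [phi], and read each
    coordinate also as the code of a set of points.  Start from a countable
    dense set of points, repeated in countably many rows, so that every finite
    cylinder meets every row.  By Zorn's lemma choose a maximal set [S] of
    coordinates that can be forced to vanish on the set they code without
    destroying this property.  Let [F n] be discrete subsets of the rows, and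
    let [i] be the coordinate coding their union.  If [i] is in [S], the union
    misses the open set [x i = true].  If not, maximality yields a cylinder
    whose trace on some row lies in [F n]; as [F n] is discrete, a smaller
    cylinder meets that row in one point, which is refuted by a coordinate not
    involved in the cylinder. *)
Require Import Defs.
From HB Require Import structures.
From mathcomp Require Import all_boot all_order all_algebra.
From mathcomp Require Import all_classical all_reals all_analysis.

Set Implicit Arguments.
Unset Strict Implicit.
Unset Printing Implicit Defensive.

Local Open Scope classical_set_scope.

Section Cylinders.
Variable I : choiceType.
Implicit Types (s : seq I) (f g : {ptws I -> bool}) (U : set {ptws I -> bool}).

Definition cylinder s f : set {ptws I -> bool} := [set g | {in s, f =1 g}].

Lemma cylinder_filter f :
  Filter (filter_from [set: seq I] (fun s => cylinder s f)).
Proof.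
apply: filter_from_filter; first by exists [::].
move=> s t _ _; exists (s ++ t) => // g gst.
by split=> i ii; apply: gst; rewrite mem_cat ii ?orbT.
Qed.

(** Convergence in the product is tested coordinatewise, and the cylinder on [[:: i]] settles
    coordinate [i]. *)
Lemma open_cylinder U f : open U -> U f -> exists s, cylinder s f `<=` U.
Proof.
move=> oU Uf.
pose G : set_system {ptws I -> bool} :=
  filter_from [set: seq I] (fun s => cylinder s f).
have GF : Filter G := cylinder_filter f.
have cG : G --> (f : {ptws I -> bool}).
  apply/cvg_sup => i A [_ [[B oB <-] Bf BA]].
  exists [:: i] => // g gi; apply: BA => /=.
  by rewrite -gi ?mem_head.
have [|s _ sU] := cG U; first exact: open_nbhs_nbhs.
by exists s.
Qed.

Lemma open_coordinate_true (i : I) : open [set f : {ptws I -> bool} | f i].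
Proof.
have oT : open [set true] by exact: discrete_open.
apply: (@continuousP {ptws I -> bool} bool (fun f => f i)).1 _ oT.
exact: (@proj_continuous I (fun=> bool) i).
Qed.

End Cylinders.

Lemma discrete_subsetP (T : topologicalType) (A : set T) (x : T) :
  discrete_subset A -> A x ->
  exists U, [/\ open U, U x & U `&` A `<=` [set x]].
Proof.
move=> dA Ax; pose x' : set_type A := SigSub (mem_set Ax).
have [U oU Ux] := dA [set x'].
exists U; split => // [|y [Uy Ay]].
  by rewrite -[U x]/((set_val @^-1` U) x') Ux.
have : (set_val @^-1` U) (SigSub (mem_set Ay) : set_type A) by [].
by rewrite Ux => /(congr1 set_val).
Qed.

Section BasePoints.

(* [(k, t)] stands for the clopen subset of the Cantor space of all sequences
   whose prefix of length [k] is listed in [t]. *)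
Definition clopen_code : countType := (nat * seq (seq bool))%type.

Definition in_clopen (m : clopen_code) (r : nat -> bool) : bool :=
  mkseq r m.1 \in m.2.

Lemma eq_mkseq_prefix (r r' : nat -> bool) (k l : nat) : (k <= l)%N ->
  mkseq r l = mkseq r' l -> mkseq r k = mkseq r' k.
Proof.
move=> kl e; apply: (@eq_from_nth _ false); rewrite !size_mkseq// => i ik.
have il := leq_trans ik kl.
by rewrite !nth_mkseq// -(nth_mkseq false r il) e nth_mkseq.
Qed.

Lemma separating_length1 (r : nat -> bool) (s : seq (nat -> bool)) :
  exists k, {in s, forall r', mkseq r k = mkseq r' k -> r = r'}.
Proof.
elim: s => [|a s [k ks]]; first by exists 0%N.
have [<-|ra] := pselect (r = a).
  by exists k => r'; rewrite inE => /predU1P[->|/ks].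
have [j raj] : exists j, r j <> a j by apply: contrapT => /forallNP h;
  apply: ra; apply/funext => j; apply: contrapT; exact: h.
(* A prefix must have length at least [j.+1] to show position [j]. *)
exists (maxn k j.+1) => r'; rewrite inE => /predU1P[->|r's] e.
  have := eq_mkseq_prefix (leq_maxr k j.+1) e.
  by move/(congr1 (fun u => nth false u j)); rewrite !nth_mkseq.
exact/ks/(eq_mkseq_prefix (leq_maxl k j.+1) e).
Qed.

Lemma separating_length (s : seq (nat -> bool)) :
  exists k, {in s &, injective (fun r => mkseq r k)}.
Proof.
suff /(_ s)[k ks] : forall t : seq (nat -> bool), exists k,
    {in t & s, forall r r', mkseq r k = mkseq r' k -> r = r'}.
  by exists k => r r' rs r's; exact: ks.
elim=> [|a t [k kt]]; first by exists 0%N.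
have [j ja] := separating_length1 a s.
exists (maxn j k) => r r'; rewrite inE => /predU1P[->|rt] r's e.
  exact/ja/(eq_mkseq_prefix (leq_maxl j k) e).
exact/kt/(eq_mkseq_prefix (leq_maxr j k) e).
Qed.

(** Cut at a length that separates [s], and list the prefixes of the points where [f] holds. *)
Lemma in_clopen_interpolation (s : seq (nat -> bool)) (f : (nat -> bool) -> bool) :
  exists m, {in s, in_clopen m =1 f}.
Proof.
have [k ks] := separating_length s.
exists (k, [seq mkseq r k | r <- s & f r]) => r rs; rewrite /in_clopen /=.
apply/mapP/idP => [[r']|fr]; last by exists r => //; rewrite mem_filter fr.
by rewrite mem_filter => /andP[fr' r's] /ks ->.
Qed.

End BasePoints.

Section Construction.
Variables (I : choiceType) (phi : I -> nat -> bool).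
Hypothesis phi_inj : injective phi.
Hypothesis phi_surj : forall r, exists i, phi i = r.
Implicit Types (S : set I) (s : seq I) (n : nat) (m : clopen_code).

(* The point with index [m] in row [n], where every coordinate in [S] has been
   forced to vanish on the set of points that it codes. *)
Definition point_of S (n : nat) (m : clopen_code) : {ptws I -> bool} :=
  fun i => in_clopen m (phi i) && ~~ (`[< S i >] && phi i (pickle (n, m))).

Definition rows_dense S : Prop :=
  forall n s (f : {ptws I -> bool}), exists m, cylinder s f (point_of S n m).

Lemma point_of_eq S S' n m i : (S i <-> S' i) ->
  point_of S n m i = point_of S' n m i.
Proof. by move=> /propext e; rewrite /point_of e. Qed.

Lemma rows_dense0 : rows_dense set0.
Proof.
move=> n s f.
have [g fg] : exists g : (nat -> bool) -> bool, forall i, g (phi i) = f i.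
  have [psi psiK] := choice phi_surj.
  by exists (f \o psi) => i /=; congr f; apply: phi_inj; rewrite psiK.
have [m ms] := in_clopen_interpolation (map phi s) g.
by exists m => i si; rewrite /point_of asboolF// andbT ms ?map_f//.
Qed.

(** A cylinder sees only the finitely many coordinates in [s]; those in the union already lie in a
    single member of the chain. *)
Lemma rows_dense_bigcup (G : set (set I)) :
  G `<=` rows_dense -> total_on G subset -> rows_dense (\bigcup_(S in G) S).
Proof.
move=> Gd Gt n s f; set U := \bigcup_(S in G) S.
have [G0|/set0P[S0 GS0]] := eqVneq G set0.
  by rewrite /U G0 bigcup_set0; exact: rows_dense0.
have [S GS sS] : exists2 S, G S & {in s, forall i, U i -> S i}.
  elim: s => [|i s [S GS sS]]; first by exists S0.
  have [[S' GS' S'i]|Ui] := pselect (U i).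
    case: (Gt _ _ GS GS') => SS'.
      exists S' => // j; rewrite inE => /predU1P[->//|js Uj].
      exact/SS'/sS.
    exists S => // j; rewrite inE => /predU1P[-> _|]; [exact: SS'|exact: sS].
  by exists S => // j; rewrite inE => /predU1P[->|/sS].
have [m sm] := Gd _ GS n s f.
exists m => i si; rewrite sm//; apply: point_of_eq; split; last exact: sS.
by move=> Si; exists S.
Qed.

Lemma maximal_rows_dense :
  exists S, rows_dense S /\ forall i, ~ S i -> ~ rows_dense (i |` S).
Proof.
have [S [Sd Smax]] := Zorn_bigcup rows_dense_bigcup.
exists S; split=> // i Si; apply: Smax; split; first exact: subsetUr.
by move=> /(_ i) iS; apply: Si; apply: iS; left.
Qed.

Lemma fresh_coordinate s : exists i, i \notin s.
Proof.
apply: contrapT => /forallNP h.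
have [psi psiK] := choice phi_surj.
(* The indicators of singletons supply infinitely many coordinates. *)
pose g (k : nat) : I := psi (fun j => j == k).
have g_inj : injective g.
  move=> k l /(congr1 phi); rewrite !psiK => /(congr1 (fun r => r k)).
  by rewrite eqxx => /esym/eqP.
have : (size (map g (iota 0 (size s).+1)) <= size s)%N.
  apply: uniq_leq_size; first by rewrite map_inj_uniq ?iota_uniq.
  by move=> i _; apply/negPn/negP; exact: h.
by rewrite size_map size_iota ltnn.
Qed.

Lemma row_no_isolated S n s f : rows_dense S -> ~ exists x,
  forall m, cylinder s f (point_of S n m) -> point_of S n m = x.
Proof.
move=> Sd [x sx]; have [i si] := fresh_coordinate s.
(* Ask for a point of the cylinder that differs from [x] at the fresh coordinate. *)
have [m sm] := Sd n (i :: s) (fun j => if j == i then ~~ x i else f j).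
have := sm i (mem_head _ _); rewrite eqxx (sx m); first by case: (x i).
move=> j js; have := sm j; rewrite inE js orbT => /(_ isT) <-.
by case: eqP => // ji; rewrite -ji js in si.
Qed.

Lemma force_coordinate S i n m : ~ phi i (pickle (n, m)) ->
  point_of (i |` S) n m = point_of S n m.
Proof.
move=> im; apply/funext => j; have [->|ji] := eqVneq j i.
  by rewrite /point_of (negPf (introN idP im)) !andbF.
by apply: point_of_eq; split=> [[/eqP|//]|]; [rewrite (negPf ji)|right].
Qed.

Lemma not_D_separable_range S : rows_dense S ->
  (forall i, ~ S i -> ~ rows_dense (i |` S)) ->
  ~ D_separable (set_type [set x | exists n m, x = point_of S n m]).
Proof.
move=> Sd Smax; set X := (X in set_type X).
pose pt n m : set_type X :=
  SigSub (mem_set (ex_intro _ n (ex_intro _ m erefl) : X (point_of S n m))).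
move=> /(_ (fun n => range (pt n)))[|F [FD dF]].
  move=> n U [x Ux] [U' oU' U'E]; subst U.
  have [s sU'] := open_cylinder oU' Ux.
  have [m sm] := Sd n s (set_val x).
  by exists (pt n m); split; [exact: sU'|exists m].
(* Pairs are coded, not bare points, so that each index is tested against the discrete set of its
   own row. *)
have [i iE] := phi_surj (fun k => `[< exists n m,
  k = pickle (n, m) /\ F n (pt n m) >]).
have iF n m : phi i (pickle (n, m)) <-> F n (pt n m).
  rewrite iE; split=> [/asboolP[n' [m' [/(pcan_inj pickleK)[-> ->]]]]//|Fm].
  by apply/asboolP; exists n, m.
have [Si|Si] := pselect (S i).
  pose U : set (set_type X) := set_val @^-1` [set f : {ptws I -> bool} | f i].
  have oU : open U by exists [set f : {ptws I -> bool} | f i] => //;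
    exact: open_coordinate_true.
  have [|x [Ux [n _ Fx]]] := dF U _ oU.
    by have [m /(_ i (mem_head _ _)) im] := Sd 0%N [:: i] (fun=> true);
      exists (pt 0%N m); exact: esym im.
  have [m _ xE] := (FD n).1 x Fx; move: Ux; rewrite -xE.
  rewrite -[U _]/(is_true (point_of S n m i)).
  by rewrite /point_of asboolT// (iF n m).2 ?xE// andbF.
apply: (Smax i Si) => n s f; apply: contrapT => /forallNP noF.
(* Forcing [i] would leave a point outside [F n] unchanged, hence still in the cylinder, against
   [noF]. *)
have sF m : cylinder s f (point_of S n m) -> F n (pt n m).
  by move=> sm; apply/iF; apply: contrapT => /(force_coordinate S) e;
    apply: (noF m); rewrite e.
have [m0 sm0] := Sd n s f.
have [U [[U' oU' U'E] Ux UF]] := discrete_subsetP (FD n).2 (sF _ sm0).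
subst U; have [t tU'] := open_cylinder oU' Ux.
(* Coordinates [s] keep the row inside [F n], and [t] keeps it inside the neighbourhood isolating
   [pt n m0]. *)
apply: (@row_no_isolated S n (s ++ t) (point_of S n m0) Sd).
exists (point_of S n m0) => m stm.
suff : pt n m = pt n m0 by move=> /(congr1 set_val).
apply: UF; split; first by apply: tU' => j jt; apply: stm; rewrite mem_cat jt orbT.
by apply: sF => j js; rewrite sm0// stm// mem_cat js.
Qed.

Lemma countable_dense_not_D_separable : exists X : set {ptws I -> bool},
  countable X /\ dense X /\ ~ D_separable (set_type X).
Proof.
have [S [Sd Smax]] := maximal_rows_dense.
exists [set x | exists n m, x = point_of S n m].
split; last split; last exact: not_D_separable_range.
  apply: (@sub_countable _ _ _ (range (fun p => point_of S p.1 p.2))).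
    by apply: subset_card_le => _ [n [m ->]]; exists (n, m).
  exact: sub_countable (card_image_le _ _) (countableP _).
move=> U [f Uf] oU; have [s sU] := open_cylinder oU Uf.
have [m sm] := Sd 0%N s f.
by exists (point_of S 0 m); split; [exact: sU|exists 0%N, m].
Qed.

End Construction.

Theorem mainTheorem9 (I : Type) (hI : has_card_continuum I) :
  exists X : set {ptws I -> bool},
    countable X /\ dense X /\ ~ D_separable (set_type X).
Proof.
have /card_set_bijP[phi [_ phi_inj phi_surj]] := hI.
apply: (@countable_dense_not_D_separable {classic I} phi).
  by move=> i j; apply: phi_inj; rewrite inE.
by move=> r; have [i _ <-] := phi_surj r Logic.I; exists i.
Qed.
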